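(* Let $h>0$, let $\alpha,\gamma>0$, $D\in\mathbb{R}$, and let $\kappa,\sigma,\rho$ be nonzero real constants with $\sigma=-1/(\gamma\kappa)$; let $\beta(0),V_1''(0),V_\epsilon''(0)$ be real constants with $V_1''(0)<0$ and $\alpha\gamma-\beta^2(0)\neq0$. Consider the linear discrete system $$\frac{\partial\mathcal L^d(q_k,q_{k+1})}{\partial\phi_k}+\frac{\partial\mathcal L^d(q_{k-1},q_k)}{\partial\phi_k}=-\Big(\frac{\rho-1}{\rho}-\frac1\sigma\Big)\frac{\beta(0)}{\gamma}\,\frac{D(\Delta x_{k-1}+\Delta x_k)}{2h},$$ $$\frac{\partial\mathcal L^d(q_k,q_{k+1})}{\partial s_k}+\frac{\partial\mathcal L^d(q_{k-1},q_k)}{\partial s_k}=-\frac{D(\Delta x_{k-1}+\Delta x_k)}{2h}.$$ If $$-\frac{\beta^2(0)}{\alpha\gamma-\beta^2(0)}<\sigma<0,\qquad \rho<0,\qquad V_\epsilon''(0)<0,$$ and $D>0$, then the equilibrium $(\phi_k,s_k)=(0,0)$ of this system is asymptotically stable.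
   Context: Variables are $q=(\phi,s)\in\mathbb{R}^2$. For a sequence $q_k=(\phi_k,s_k)$ write $q_{k+1/2}=(q_k+q_{k+1})/2$ (componentwise) and $\Delta q_k=q_{k+1}-q_k$. Put $$x=s+\Big(\frac{\rho-1}{\rho}-\frac1\sigma\Big)\frac{\beta(0)}{\gamma}\,\phi,$$ let $x_k$ be its value at $(\phi_k,s_k)$, $\Delta x_k=x_{k+1}-x_k$, and let $\tau_0=\kappa\beta(0)$. The function $\mathcal L^d$ (the quadratic approximation at the equilibrium of the discrete controlled Lagrangian) is $\mathcal L^d(q_k,q_{k+1})=h\,\mathcal L(q_{k+1/2},\Delta q_k/h)$, where $$\mathcal L(\phi,s,\dot\phi,\dot s)=\tfrac12\big[\alpha\dot\phi^2+2\beta(0)\dot\phi(\dot s+\tau_0\dot\phi)+\gamma(\dot s+\tau_0\dot\phi)^2\big]+\tfrac12\sigma\gamma(\tau_0\dot\phi)^2+\tfrac12(\rho-1)\gamma\big(\dot s-(\sigma-1)\tau_0\dot\phi\big)^2-\tfrac12V_1''(0)\phi^2-\tfrac12V_\epsilon''(0)x^2.$$ Here $V_1$ is the shape potential, with a non-degenerate maximum at $\phi=0$, and $V_\epsilon$ is the negative-definite function used to shape the potential in the group direction; only their second derivatives at $0$ enter. Asymptotic stability refers to the discrete dynamics $(q_{k-1},q_k)\mapsto(q_k,q_{k+1})$ on $\mathbb{R}^4$ defined by the system. *)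

(* Defs.v *)
From mathcomp Require Import all_boot all_order all_algebra.
From mathcomp Require Import all_classical all_reals all_analysis.
Set Implicit Arguments.
Unset Strict Implicit.
Unset Printing Implicit Defensive.
Import Order.TTheory GRing.Theory Num.Theory.
Import numFieldNormedType.Exports.
Local Open Scope classical_set_scope.
Local Open Scope ring_scope.

Definition lyapunov_stable (T : topologicalType) (f : T -> T) (x0 : T) : Prop :=
  forall U : set T, nbhs x0 U ->
  exists2 V : set T, nbhs x0 V & forall x n, V x -> U (iter n f x).

Definition locally_attractive (T : topologicalType) (f : T -> T) (x0 : T) : Prop :=
  \forall x \near x0, iter n f x @[n --> \oo] --> x0.

Definition asymptotically_stable (T : topologicalType) (f : T -> T) (x0 : T) : Prop :=
  [/\ f x0 = x0, lyapunov_stable f x0 & locally_attractive f x0].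

(* [beta0], [V1dd] and [Vedd] stand for beta(0), V_1''(0) and V_epsilon''(0). *)
Record constants (R : realType) := Constants {
  alpha : R; gamma : R; beta0 : R;
  kappa : R; sigma : R; rho : R;
  V1dd : R; Vedd : R }.

(* Configurations and velocities are pairs whose first component is the shape
   coordinate phi and whose second component is the group coordinate s. *)

Definition tau0 (R : realType) (p : constants R) : R := kappa p * beta0 p.

Definition xcoef (R : realType) (p : constants R) : R :=
  ((rho p - 1) / rho p - 1 / sigma p) * (beta0 p / gamma p).

Definition xcoord (R : realType) (p : constants R) (q : R * R) : R :=
  q.2 + xcoef p * q.1.

Definition lagrangian (R : realType) (p : constants R) (q v : R * R) : R :=
  1 / 2 * (alpha p * v.1 ^+ 2
           + 2 * beta0 p * v.1 * (v.2 + tau0 p * v.1)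
           + gamma p * (v.2 + tau0 p * v.1) ^+ 2)
  + 1 / 2 * sigma p * gamma p * (tau0 p * v.1) ^+ 2
  + 1 / 2 * (rho p - 1) * gamma p * (v.2 - (sigma p - 1) * tau0 p * v.1) ^+ 2
  - 1 / 2 * V1dd p * q.1 ^+ 2
  - 1 / 2 * Vedd p * xcoord p q ^+ 2.

Definition discrete_lagrangian (R : realType) (p : constants R) (h : R)
    (q q' : R * R) : R :=
  h * lagrangian p ((q.1 + q'.1) / 2, (q.2 + q'.2) / 2)
                   ((q'.1 - q.1) / h, (q'.2 - q.2) / h).

Definition partial_phi (R : realType) (f : R * R -> R) (q : R * R) : R :=
  derive1 (fun t : R => f (t, q.2)) q.1.

Definition partial_s (R : realType) (f : R * R -> R) (q : R * R) : R :=
  derive1 (fun t : R => f (q.1, t)) q.2.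

Definition dissipation (R : realType) (p : constants R) (h D : R)
    (qprev q qnext : R * R) : R :=
  D * ((xcoord p q - xcoord p qprev) + (xcoord p qnext - xcoord p q)) / (2 * h).

(* The system at one index k, with (qprev, q, qnext) = (q_{k-1}, q_k, q_{k+1}). *)
Definition discrete_system (R : realType) (p : constants R) (h D : R)
    (qprev q qnext : R * R) : Prop :=
  partial_phi (fun u => discrete_lagrangian p h u qnext) q
    + partial_phi (fun u => discrete_lagrangian p h qprev u) q
    = - xcoef p * dissipation p h D qprev q qnext
  /\
  partial_s (fun u => discrete_lagrangian p h u qnext) q
    + partial_s (fun u => discrete_lagrangian p h qprev u) q
    = - dissipation p h D qprev q qnext.

(* The system is implicit in q_{k+1}: [F] is the map
   (q_{k-1}, q_k) |-> (q_k, q_{k+1}) it defines on R^4 when each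
   (q_{k-1}, q_k) has exactly one successor, namely [F (q_{k-1}, q_k)]. *)
Definition is_dynamics_of (R : realType) (p : constants R) (h D : R)
    (F : (R * R) * (R * R) -> (R * R) * (R * R)) : Prop :=
  forall z w, w = F z <-> (w.1 = z.2 /\ discrete_system p h D z.1 z.2 w.2).

(* Main.v *)
(* In the coordinates (phi, x) the discrete Lagrangian is, up to sign, a positive
   definite kinetic form minus a positive definite potential form, and the
   dissipation acts on x alone. Multiplying the equations by q_{k+1} - q_{k-1}
   and adding them shows that a positive definite quadratic energy of
   (q_k, q_{k+1}) decreases by (D/2) (x_{k+1} - x_{k-1})^2 at each step. Hence the
   equilibrium is stable, and x_{k+1} - x_{k-1} -> 0 along every orbit; since the
   two coordinates are coupled (beta(0) <> 0), taking linear combinations of the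
   shifted equations forces phi_k -> 0 and x_k -> 0. *)
Require Import Defs.
From mathcomp Require Import all_boot all_order all_algebra.
From mathcomp Require Import all_classical all_reals all_analysis.
From mathcomp Require Import ring lra.
Set Implicit Arguments.
Unset Strict Implicit.
Unset Printing Implicit Defensive.
Import Order.TTheory GRing.Theory Num.Theory.
Import numFieldNormedType.Exports.
Local Open Scope classical_set_scope.
Local Open Scope ring_scope.

(** * Derivatives of quadratic functions and linear elimination *)

(* The hypothesis says that f is a polynomial of degree at most 2, without naming
   its coefficients; for such f the central difference is the exact derivative. *)
Lemma derive1_quadratic (R : realType) (f : R -> R) (t : R) :
  (forall r, f r = f 0 + r * ((f 1 - f (-1)) / 2)
                   + r ^+ 2 * ((f 1 + f (-1) - 2 * f 0) / 2)) ->
  derive1 f t = (f (t + 1) - f (t - 1)) / 2.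
Proof.
move=> fE.
set b := (f 1 - f (-1)) / 2 in fE; set a := (_ / 2) in fE.
have der : is_derive t 1 f (b + 2 * a * t).
  have -> : f = (fun r => f 0 + r * b + r ^+ 2 * a) by apply/funext.
  by apply: is_derive_eq; rewrite /GRing.scale /= ; ring.
by rewrite derive1E derive_val (fE (t + 1)) (fE (t - 1)); field.
Qed.

(** Turns elimination into one polynomial identity: [c1] and [c2] are the multipliers of two
    vanishing expressions that certify [l = r]. *)
Lemma eq_of_residuals (R : comRingType) (l r c1 c2 r1 r2 : R) :
  r1 = 0 -> r2 = 0 -> l - r = c1 * r1 + c2 * r2 -> l = r.
Proof. by move=> -> -> /eqP; rewrite !mulr0 addr0 subr_eq0 => /eqP. Qed.

(** * The reduced system and its energy balance *)

(* The discrete system times h, in the coordinates (phi, x): the kinetic form is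
   a phi'^2 + g (x' + d phi')^2 up to sign, U = - h^2 V_1''(0) / 4,
   W = - h^2 V_epsilon''(0) / 4 and K = D / 2. *)
Definition reduced_system (R : realType) (a g d U W K : R)
    (phi x phi' x' phi'' x'' : R) : Prop :=
  (a + g * d ^+ 2) * (phi'' - 2 * phi' + phi) + g * d * (x'' - 2 * x' + x)
    + U * (phi'' + 2 * phi' + phi) = 0
  /\ g * d * (phi'' - 2 * phi' + phi) + g * (x'' - 2 * x' + x)
    + W * (x'' + 2 * x' + x) + K * (x'' - x) = 0.

Definition reduced_energy (R : realType) (a g d U W : R)
    (phi x phi' x' : R) : R :=
  a * (phi' - phi) ^+ 2 + g * ((x' - x) + d * (phi' - phi)) ^+ 2
  + U * (phi' + phi) ^+ 2 + W * (x' + x) ^+ 2.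

(** The products telescope: [phi'' - phi] times a second difference is a difference of squared
    increments, and times [phi'' + 2 * phi' + phi] a difference of squared sums; likewise for x and
    the cross terms. *)
Lemma reduced_energy_step (R : realType) (a g d U W K : R)
    (phi x phi' x' phi'' x'' : R) :
  reduced_system a g d U W K phi x phi' x' phi'' x'' ->
  reduced_energy a g d U W phi' x' phi'' x''
  = reduced_energy a g d U W phi x phi' x' - K * (x'' - x) ^+ 2.
Proof.
move=> [e1 e2].
apply: (eq_of_residuals (c1 := phi'' - phi) (c2 := x'' - x) e1 e2).
by rewrite /reduced_energy; ring.
Qed.

(** * Convergence of the orbits of the reduced system *)

Lemma cvg0_comb (R : realType) (u v w : nat -> R) (a b : R) :
  u n @[n --> \oo] --> 0 -> v n @[n --> \oo] --> 0 ->
  (forall n, w n = a * u n + b * v n) -> w n @[n --> \oo] --> 0.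
Proof.
move=> u0 v0 /funext ->.
have -> : 0 = a * 0 + b * 0 :> R by ring.
by apply: cvgD; apply: cvgM => //; exact: cvg_cst.
Qed.

Lemma cvg0_shift (R : realType) (u : nat -> R) :
  u n @[n --> \oo] --> 0 -> u n.+1 @[n --> \oo] --> 0.
Proof. by move=> u0; rewrite cvg_shiftS. Qed.

Lemma cvg0_sqr (R : realType) (u : nat -> R) :
  u n ^+ 2 @[n --> \oo] --> 0 -> u n @[n --> \oo] --> 0.
Proof.
move=> /cvgr0Pnorm_lt u0; apply/cvgr0Pnorm_lt => e e0.
have := u0 _ (exprn_gt0 2 e0); apply: filterS => n.
by rewrite normrX ltr_pXn2r ?nnegrE // ltW.
Qed.

(** An explicit LaSalle argument: the energy decreases and is bounded below, so its decrements
    vanish in the limit; every later limit is a linear combination of shifts of earlier ones. *)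
Lemma reduced_attractive (R : realType) (a g d U W K : R) (phi x : nat -> R)
    (a0 : 0 < a) (g0 : 0 < g) (d0 : d != 0) (U0 : 0 < U) (W0 : 0 < W) (K0 : 0 < K) :
  (forall n, reduced_system a g d U W K (phi n) (x n) (phi n.+1) (x n.+1)
    (phi n.+2) (x n.+2)) ->
  phi n @[n --> \oo] --> 0 /\ x n @[n --> \oo] --> 0.
Proof.
move=> sys.
pose E n := reduced_energy a g d U W (phi n) (x n) (phi n.+1) (x n.+1).
have Estep n : E n.+1 = E n - K * (x n.+2 - x n) ^+ 2.
  exact: reduced_energy_step.
have E_ge0 n : 0 <= E n.
  by rewrite !addr_ge0 // mulr_ge0 ?sqr_ge0 // ltW.
have Ecvg : cvgn E.
  apply: nonincreasing_is_cvgn; last by exists 0 => _ [n _ <-].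
  apply/nonincreasing_seqP => n; rewrite Estep lerBlDr lerDl.
  by rewrite mulr_ge0 ?sqr_ge0 // ltW.
have diss0 : E n - E n.+1 @[n --> \oo] --> 0.
  rewrite -(subrr (limn E)); apply: cvgB => //.
  by rewrite cvg_shiftS.
pose y n := x n.+2 - x n.
have y0 : y n @[n --> \oo] --> 0.
  apply: cvg0_sqr; apply: (cvg0_comb (a := K^-1) (b := 0) diss0 diss0) => n.
  by rewrite Estep /y; field; rewrite gt_eqF.
have y1 := cvg0_shift y0.
(* f, X are the second differences and M, m the means (times 4) of phi and x. *)
pose f n := phi n.+2 - 2 * phi n.+1 + phi n.
pose X n := x n.+2 - 2 * x n.+1 + x n.
pose M n := phi n.+2 + 2 * phi n.+1 + phi n.
pose m n := x n.+2 + 2 * x n.+1 + x n.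
have e1 n : (a + g * d ^+ 2) * f n + g * d * X n + U * M n = 0 by case: (sys n).
have e2 n : g * d * f n + g * X n + W * m n + K * y n = 0 by case: (sys n).
have XX : X n.+1 + X n @[n --> \oo] --> 0.
  by apply: (cvg0_comb (a := 1) (b := -1) y1 y0) => n; rewrite /X /y; ring.
have mm : m n.+1 - m n @[n --> \oo] --> 0.
  by apply: (cvg0_comb (a := 1) (b := 1) y1 y0) => n; rewrite /m /y; ring.
have X2 : X n.+2 - X n @[n --> \oo] --> 0.
  apply: (cvg0_comb (a := 1) (b := -1) (cvg0_shift XX) XX) => n.
  by ring.
have m2 : m n.+2 - m n @[n --> \oo] --> 0.
  apply: (cvg0_comb (a := 1) (b := 1) (cvg0_shift mm) mm) => n.
  by ring.
have y2 : y n.+2 - y n @[n --> \oo] --> 0.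
  by apply: (cvg0_comb (a := 1) (b := -1) (cvg0_shift y1) y0) => n; ring.
(* The coupling enters here: as [d] is nonzero, the second equation expresses the second difference
   of phi through x alone. *)
have fE n : f n = - (g * X n + W * m n + K * y n) / (g * d).
  apply: (eq_of_residuals (c1 := (g * d)^-1) (c2 := 0) (e2 n) (erefl 0)).
  by field; rewrite ?d0 ?gt_eqF.
(* From here on the shifts by 2 and the sums of neighbours are controlled: an orbit
   along which y vanishes has period 2, so only its constant and alternating parts
   remain to be excluded. *)
have f2 : f n.+2 - f n @[n --> \oo] --> 0.
  have Xm := cvg0_comb (a := g) (b := W) X2 m2 (fun=> erefl).
  apply: (cvg0_comb (a := - (g * d)^-1) (b := - (K / (g * d))) Xm y2) => n.
  by rewrite !fE; field; rewrite ?d0 ?gt_eqF.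
(* Since [M n = f n + 4 * phi n.+1], the first equation gives the middle value of phi. *)
have phiE n : phi n.+1 = - ((a + g * d ^+ 2 + U) * f n + g * d * X n) / (4 * U).
  apply: (eq_of_residuals (c1 := (4 * U)^-1) (c2 := 0) (e1 n) (erefl 0)).
  by rewrite /M /f; field; rewrite gt_eqF.
have phi2 : phi n.+3 - phi n.+1 @[n --> \oo] --> 0.
  apply: (cvg0_comb (a := - ((a + g * d ^+ 2 + U) / (4 * U)))
    (b := - (g * d / (4 * U))) f2 X2) => n.
  by rewrite !phiE; field; rewrite gt_eqF.
have ff : f n.+2 + f n.+1 @[n --> \oo] --> 0.
  apply: (cvg0_comb (a := 1) (b := -1) (cvg0_shift phi2) phi2) => n.
  by rewrite /f; ring.
(* Adding the second equation at two consecutive indices leaves only [W] times a sum of neighbouring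
   values of [m]; their difference already tends to 0. *)
have mlim : m n.+1 @[n --> \oo] --> 0.
  have u1 := cvg0_comb (a := g * d) (b := g) ff (cvg0_shift XX) (fun=> erefl).
  have u2 := cvg0_comb (a := K) (b := K) (cvg0_shift y1) y1 (fun=> erefl).
  have u3 := cvg0_comb (a := 1) (b := 1) u1 u2 (fun=> erefl).
  apply: (cvg0_comb (a := - (2 * W)^-1) (b := - 2^-1) u3 (cvg0_shift mm)) => n /=.
  rewrite !fE; field.
  by rewrite ?d0 ?gt_eqF.
have phiphi : phi n.+3 + phi n.+2 @[n --> \oo] --> 0.
  apply: (cvg0_comb (a := - ((a + g * d ^+ 2 + U) / (4 * U)))
    (b := - (g * d / (4 * U))) ff (cvg0_shift XX)) => n.
  by rewrite !phiE; field; rewrite gt_eqF.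
have Mlim : M n.+2 @[n --> \oo] --> 0.
  apply: (cvg0_comb (a := 1) (b := 1) (cvg0_shift phiphi) phiphi) => n.
  by rewrite /M; ring.
(* The first equation minus [d] times the second is free of [X], leaving [a * f] in terms of [M],
   [m] and [y]. *)
have flim : f n.+2 @[n --> \oo] --> 0.
  have v := cvg0_comb (a := d * W / a) (b := d * K / a) (cvg0_shift mlim)
    (cvg0_shift y1) (fun=> erefl).
  apply: (cvg0_comb (a := 1) (b := - (U / a)) v Mlim) => n /=.
  apply: (eq_of_residuals (c1 := a^-1) (c2 := - (d / a)) (e1 n.+2) (e2 n.+2)).
  by field; rewrite gt_eqF.
have Xlim : X n.+2 @[n --> \oo] --> 0.
  have v := cvg0_comb (a := - (W / g)) (b := - (K / g)) (cvg0_shift mlim)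
    (cvg0_shift y1) (fun=> erefl).
  apply: (cvg0_comb (a := 1) (b := - d) v flim) => n /=.
  by rewrite fE; field; rewrite ?d0 ?gt_eqF.
(* [M - f] and [m - X] are four times the middle value, which has index [n + 3] here. *)
split; rewrite -(cvg_shiftn 3).
  apply: (cvg0_comb (a := 4^-1) (b := - 4^-1) Mlim flim) => n.
  by rewrite addn3 /M /f; field.
apply: (cvg0_comb (a := 4^-1) (b := - 4^-1) (cvg0_shift mlim) Xlim) => n.
by rewrite addn3 /m /X; field.
Qed.

(** * Coercivity of the energy and solvability for the next state *)

(** Each squared term is below [e ^+ 2], and half sums and differences recover the coordinates; the
    factor [1 + |d|] pays for removing the coupling from the increment of x. *)
Lemma reduced_energy_coercive (R : realType) (a g d U W : R)
    (phi x phi' x' e : R)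
    (a0 : 0 < a) (g0 : 0 < g) (U0 : 0 < U) (W0 : 0 < W) (e0 : 0 < e) :
  reduced_energy a g d U W phi x phi' x'
    < Num.min (Num.min a g) (Num.min U W) * e ^+ 2 ->
  [/\ `|phi| < e, `|phi'| < e,
      `|x| < (1 + `|d|) * e & `|x'| < (1 + `|d|) * e].
Proof.
set m := Num.min _ _ => Elt.
have small b t : m <= b -> 0 < b ->
    b * t ^+ 2 <= reduced_energy a g d U W phi x phi' x' -> `|t| < e.
  move=> mb b0 bt.
  have : b * t ^+ 2 < b * e ^+ 2.
    apply: (le_lt_trans bt); apply: (lt_le_trans Elt).
    by rewrite ler_wpM2r ?sqr_ge0.
  by rewrite ltr_pM2l // -(real_normK (num_real t)) ltr_pXn2r ?nnegrE // ltW.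
have [ma mg mU mW] : [/\ m <= a, m <= g, m <= U & m <= W].
  by split; rewrite /m !ge_min lexx ?orbT.
have sq_ge0 (b t : R) : 0 < b -> 0 <= b * t ^+ 2.
  by move=> b0; rewrite mulr_ge0 ?sqr_ge0 // ltW.
have a_ge := sq_ge0 _ (phi' - phi) a0.
have g_ge := sq_ge0 _ (x' - x + d * (phi' - phi)) g0.
have U_ge := sq_ge0 _ (phi' + phi) U0.
have W_ge := sq_ge0 _ (x' + x) W0.
have dphi : `|phi' - phi| < e by apply: (small a) => //; rewrite /reduced_energy; lra.
have dx : `|x' - x + d * (phi' - phi)| < e.
  by apply: (small g) => //; rewrite /reduced_energy; lra.
have sphi : `|phi' + phi| < e by apply: (small U) => //; rewrite /reduced_energy; lra.
have sx : `|x' + x| < e by apply: (small W) => //; rewrite /reduced_energy; lra.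
have ddphi : `|d * (phi' - phi)| <= `|d| * e by rewrite normrM ler_wpM2l // ltW.
have de0 : 0 <= `|d| * e by rewrite mulr_ge0 // ltW.
move: dphi dx sphi sx ddphi; rewrite !ltr_norml !ler_norml.
move=> /andP[? ?] /andP[? ?] /andP[? ?] /andP[? ?] /andP[? ?].
by split; apply/andP; split; lra.
Qed.

(** Cramer's rule for the symmetric system in (phi'', x'') with diagonal [A], [B], off-diagonal
    entry [g * d] and right-hand sides [r], [t]. *)
Definition reduced_next (R : realType) (a g d U W K phi x phi' x' : R) : R * R :=
  let A := a + g * d ^+ 2 + U in let B := g + W + K in
  let r := (a + g * d ^+ 2) * (2 * phi' - phi) + g * d * (2 * x' - x)
           - U * (2 * phi' + phi) in
  let t := g * d * (2 * phi' - phi) + g * (2 * x' - x)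
           - W * (2 * x' + x) + K * x in
  let det := A * B - (g * d) ^+ 2 in
  ((B * r - g * d * t) / det, (A * t - g * d * r) / det).

Lemma reduced_systemP (R : realType) (a g d U W K phi x phi' x' : R) (w : R * R)
    (a0 : 0 < a) (g0 : 0 < g) (U0 : 0 < U) (W0 : 0 < W) (K0 : 0 < K) :
  reduced_system a g d U W K phi x phi' x' w.1 w.2 <->
  w = reduced_next a g d U W K phi x phi' x'.
Proof.
have det0 : (a + g * d ^+ 2 + U) * (g + W + K) - (g * d) ^+ 2 != 0.
  (* The square of [g * d] cancels, leaving a positive term plus a nonnegative one. *)
  have -> : (a + g * d ^+ 2 + U) * (g + W + K) - (g * d) ^+ 2
    = (a + U) * (g + W + K) + g * (W + K) * d ^+ 2 by ring.
  rewrite gt_eqF // ltr_pwDl //; last by rewrite mulr_ge0 ?sqr_ge0 // ltW ?mulr_gt0 ?addr_gt0.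
  by rewrite mulr_gt0 ?addr_gt0.
rewrite /reduced_next; set det := (X in _ / X).
have {}det0 : det != 0 by [].
split=> [[e1 e2]|->].
- rewrite [w]surjective_pairing; congr pair.
  + apply: (eq_of_residuals (c1 := (g + W + K) / det) (c2 := - (g * d / det)) e1 e2).
    by rewrite /det; field.
  + apply: (eq_of_residuals (c1 := - (g * d / det))
      (c2 := (a + g * d ^+ 2 + U) / det) e1 e2).
    by rewrite /det; field.
- by rewrite /reduced_system /det /=; split; field.
Qed.

(** * From the discrete Euler-Lagrange equations to the reduced system *)

(* Completing the square in the velocities of the kinetic energy, after the
   substitution tau_0 = - beta(0) / (gamma sigma). *)
Definition shape_mass (R : realType) (p : constants R) : R :=
  - (alpha p - beta0 p ^+ 2 / gamma p + beta0 p ^+ 2 / (gamma p * sigma p)).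

Definition coupling (R : realType) (p : constants R) : R :=
  beta0 p / (rho p * gamma p).

Lemma lagrangianE (R : realType) (p : constants R) (q v : R * R)
    (gamma_neq0 : gamma p != 0) (kappa_neq0 : kappa p != 0)
    (sigma_neq0 : sigma p != 0) (rho_neq0 : rho p != 0)
    (sigmaE : sigma p = - (1 / (gamma p * kappa p))) :
  lagrangian p q v =
  - (shape_mass p * v.1 ^+ 2
     - rho p * gamma p * (xcoord p v + coupling p * v.1) ^+ 2
     + V1dd p * q.1 ^+ 2 + Vedd p * xcoord p q ^+ 2) / 2.
Proof.
have kappaE : kappa p = - (1 / (gamma p * sigma p)).
  by rewrite sigmaE; field; rewrite gamma_neq0 kappa_neq0.
rewrite /lagrangian /shape_mass /coupling /xcoord /xcoef /tau0 kappaE.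
by field; rewrite gamma_neq0 sigma_neq0 rho_neq0.
Qed.

Lemma discrete_systemE (R : realType) (p : constants R) (h D : R)
    (qprev q qnext : R * R)
    (h_neq0 : h != 0) (gamma_neq0 : gamma p != 0) (kappa_neq0 : kappa p != 0)
    (sigma_neq0 : sigma p != 0) (rho_neq0 : rho p != 0)
    (sigmaE : sigma p = - (1 / (gamma p * kappa p))) :
  discrete_system p h D qprev q qnext <->
  reduced_system (shape_mass p) (- (rho p * gamma p)) (coupling p)
    (- (h ^+ 2 * V1dd p / 4)) (- (h ^+ 2 * Vedd p / 4)) (D / 2)
    qprev.1 (xcoord p qprev) q.1 (xcoord p q) qnext.1 (xcoord p qnext).
Proof.
have LdE q1 q2 : discrete_lagrangian p h q1 q2 =
    h * (- (shape_mass p * ((q2.1 - q1.1) / h) ^+ 2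
       - rho p * gamma p * ((xcoord p q2 - xcoord p q1) / h
           + coupling p * ((q2.1 - q1.1) / h)) ^+ 2
       + V1dd p * ((q1.1 + q2.1) / 2) ^+ 2
       + Vedd p * ((xcoord p q1 + xcoord p q2) / 2) ^+ 2) / 2).
  by rewrite /discrete_lagrangian lagrangianE // /xcoord /=; field.
rewrite /discrete_system /reduced_system.
set L1 := (X in _ <-> X = 0 /\ _); set L2 := (X in _ <-> _ /\ X = 0).
set Sphi := (X in X = _ /\ _ <-> _); set Ss := (X in _ /\ X = _ <-> _).
(* d/ds at fixed phi is d/dx, and d/dphi at fixed s is d/dphi + c d/dx with
   c = xcoef p, which is the factor in the phi-component of the force. *)
have SsE : Ss = L2 / h - dissipation p h D qprev q qnext.
  rewrite /Ss /partial_s !derive1_quadratic; last 2 first.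
  - by move=> r; rewrite !LdE /xcoord /=; field.
  - by move=> r; rewrite !LdE /xcoord /=; field.
  by rewrite !LdE /L2 /dissipation /xcoord /=; field.
have SphiE : Sphi = (L1 + xcoef p * L2) / h
    - xcoef p * dissipation p h D qprev q qnext.
  rewrite /Sphi /partial_phi !derive1_quadratic; last 2 first.
  - by move=> r; rewrite !LdE /xcoord /=; field.
  - by move=> r; rewrite !LdE /xcoord /=; field.
  by rewrite !LdE /L1 /L2 /dissipation /xcoord /=; field.
(* The passage from [L1], [L2] to the two equations is triangular: the s-equation gives [L2 = 0],
   and then the phi-equation gives [L1 = 0]. *)
rewrite SsE SphiE; split=> [[e1 e2]|[-> ->]]; last by split; ring.
have L20 : L2 = 0.
  apply: (mulIf (invr_neq0 h_neq0)); apply: (addIr (- dissipation p h D qprev q qnext)).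
  by rewrite e2 mul0r add0r.
split=> //; apply: (mulIf (invr_neq0 h_neq0)).
apply: (addIr (- xcoef p * dissipation p h D qprev q qnext)).
by rewrite mul0r add0r -[RHS]e1 L20 mulr0 addr0 mulNr.
Qed.

(** * Stability and attraction on the phase space *)

Lemma continuous_reduced_energy (R : realType) (p : constants R) (a g d U W : R) :
  continuous (fun z : (R * R) * (R * R) =>
    reduced_energy a g d U W z.1.1 (xcoord p z.1) z.2.1 (xcoord p z.2)).
Proof.
pose T : topologicalType := ((R * R) * (R * R))%type.
have cD (f k : T -> R) : continuous f -> continuous k ->
    continuous (fun z => f z + k z).
  by move=> cf ck z; apply: cvgD; [exact: cf | exact: ck].
have cB (f k : T -> R) : continuous f -> continuous k ->
    continuous (fun z => f z - k z).
  by move=> cf ck z; apply: cvgB; [exact: cf | exact: ck].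
have cZ (b : R) (f : T -> R) : continuous f -> continuous (fun z => b * f z).
  by move=> cf z; apply: cvgM; [exact: cvg_cst | exact: cf].
have cS (b : R) (f : T -> R) : continuous f -> continuous (fun z => b * f z ^+ 2).
  by move=> cf; apply: cZ => z; apply: cvgM; exact: cf.
have c11 : continuous (fun z : T => z.1.1).
  by move=> z; apply: cvg_comp; [exact: cvg_fst | exact: cvg_fst].
have c12 : continuous (fun z : T => z.1.2).
  by move=> z; apply: cvg_comp; [exact: cvg_fst | exact: cvg_snd].
have c21 : continuous (fun z : T => z.2.1).
  by move=> z; apply: cvg_comp; [exact: cvg_snd | exact: cvg_fst].
have c22 : continuous (fun z : T => z.2.2).
  by move=> z; apply: cvg_comp; [exact: cvg_snd | exact: cvg_snd].
have cx1 : continuous (fun z : T => xcoord p z.1) by apply: (cD) => //; exact: cZ.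
have cx2 : continuous (fun z : T => xcoord p z.2) by apply: (cD) => //; exact: cZ.
apply: (cD); last by apply: (cS); exact: cD.
apply: (cD); last by apply: (cS); exact: cD.
apply: (cD); first by apply: (cS); exact: cB.
by apply: (cS); apply: (cD); [exact: cB | apply: (cZ); exact: cB].
Qed.

Lemma asymptotically_stable_reduced (R : realType) (p : constants R)
    (a g d U W K : R) (F : (R * R) * (R * R) -> (R * R) * (R * R))
    (a0 : 0 < a) (g0 : 0 < g) (d0 : d != 0) (U0 : 0 < U) (W0 : 0 < W) (K0 : 0 < K) :
  F ((0, 0), (0, 0)) = ((0, 0), (0, 0)) ->
  (forall z, (F z).1 = z.2 /\
    reduced_system a g d U W K z.1.1 (xcoord p z.1) z.2.1 (xcoord p z.2)
      (F z).2.1 (xcoord p (F z).2)) ->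
  asymptotically_stable F ((0, 0), (0, 0)).
Proof.
move=> F0 Fsys.
pose c := xcoef p.
pose E (z : (R * R) * (R * R)) :=
  reduced_energy a g d U W z.1.1 (xcoord p z.1) z.2.1 (xcoord p z.2).
have E_le z n : E (iter n F z) <= E z.
  elim: n => //= n; apply: le_trans; case: (Fsys (iter n F z)) => F1 /reduced_energy_step.
  rewrite /E F1 => ->.
  by rewrite gerBl mulr_ge0 ?sqr_ge0 // ltW.
split=> //.
- move=> N /nbhs_ballP[e /= e0 eN].
  (* On the energy sublevel set, |phi| < [eta] and |x| < (1 + |d|) [eta]; as s = x - c phi, this [b]
     gives |s| < [b * eta] = [e]. *)
  pose b := 1 + `|d| + `|c|.
  have b0 : 0 < b by rewrite /b -addrA ltr_pwDl // addr_ge0.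
  pose eta := e / b.
  have eta0 : 0 < eta by rewrite divr_gt0.
  pose lvl := Num.min (Num.min a g) (Num.min U W) * eta ^+ 2.
  have lvl0 : 0 < lvl by rewrite mulr_gt0 ?exprn_gt0 // !lt_min a0 g0 U0 W0.
  have Econt : continuous E by exact: continuous_reduced_energy.
  have E0 : E ((0, 0), (0, 0)) = 0 by rewrite /E /reduced_energy /xcoord /=; ring.
  exists [set z | E z < lvl].
    have /cvgrPdist_lt /(_ lvl lvl0) := Econt ((0, 0), (0, 0)).
    apply: filterS => z /=; rewrite E0 sub0r normrN; exact: le_lt_trans (ler_norm _).
  move=> z n Ez; apply: eN.
  have := le_lt_trans (E_le z n) Ez; move: (iter n F z) => w Ew.
  have [phi1 phi2 x1 x2] := reduced_energy_coercive a0 g0 U0 W0 eta0 Ew.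
  have etab : e = (1 + `|d|) * eta + `|c| * eta.
    by rewrite -mulrDl -/b /eta mulrC divfK ?gt_eqF.
  have eta_le : eta <= e.
    by rewrite etab mulrDl mul1r -addrA lerDl addr_ge0 // mulr_ge0 // ltW.
  have s_lt (q : R * R) : `|q.1| < eta -> `|xcoord p q| < (1 + `|d|) * eta -> `|q.2| < e.
    move=> q1 q2; have -> : q.2 = xcoord p q - c * q.1 by rewrite /xcoord /c; ring.
    rewrite etab; apply: (le_lt_trans (ler_normB _ _)); apply: ltr_leD => //.
    by rewrite normrM ler_wpM2l // ltW.
  have coord_lt (q : R * R) : `|q.1| < eta -> `|xcoord p q| < (1 + `|d|) * eta ->
      ball ((0, 0) : R * R) e q.
    move=> q1 q2; split; rewrite -ball_normE /= sub0r normrN.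
      exact: lt_le_trans eta_le.
    exact: s_lt.
  by split; exact: coord_lt.
- near=> z.
  (* Consecutive states overlap, so an orbit of [F] is a sliding window over one sequence [q]. *)
  pose q n := (iter n F z).1.
  have iterE n : iter n F z = (q n, q n.+1).
    by rewrite /q iterS (Fsys _).1 -surjective_pairing.
  have sys n : reduced_system a g d U W K (q n).1 (xcoord p (q n)) (q n.+1).1
      (xcoord p (q n.+1)) (q n.+2).1 (xcoord p (q n.+2)).
    by have [_] := Fsys (iter n F z); rewrite -iterS !iterE.
  have [phi0 x0] := reduced_attractive a0 g0 d0 U0 W0 K0 sys.
  have s0 : (q n).2 @[n --> \oo] --> 0.
    by apply: (cvg0_comb (a := 1) (b := - c) x0 phi0) => n; rewrite /xcoord /c; ring.
  have lim0 (u : nat -> R * R) : (u n).1 @[n --> \oo] --> 0 ->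
      (u n).2 @[n --> \oo] --> 0 -> u n @[n --> \oo] --> (0, 0).
    move=> u1 u2; have -> : u = (fun n => ((u n).1, (u n).2)).
      by apply/funext => n; rewrite -surjective_pairing.
    exact: (@cvg_pair _ _ _ _ (nbhs (0 : R)) (nbhs (0 : R))).
  have -> : (fun n => iter n F z) = (fun n => (q n, q n.+1)) by apply/funext.
  apply: (@cvg_pair _ _ _ _ (nbhs ((0, 0) : R * R)) (nbhs ((0, 0) : R * R))).
    exact: lim0.
  by apply: (lim0 (fun n => q n.+1)); [exact: (cvg0_shift phi0) | exact: (cvg0_shift s0)].
Unshelve. all: by end_near.
Qed.

(** * Signs of the constants and construction of the dynamics *)

Theorem theorem6 (R : realType) (p : constants R) (h D : R)
  (h_gt0 : 0 < h) (alpha_gt0 : 0 < alpha p) (gamma_gt0 : 0 < gamma p)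
  (kappa_neq0 : kappa p != 0) (sigma_neq0 : sigma p != 0) (rho_neq0 : rho p != 0)
  (sigmaE : sigma p = - (1 / (gamma p * kappa p)))
  (V1dd_lt0 : V1dd p < 0)
  (nondeg : alpha p * gamma p - beta0 p ^+ 2 != 0)
  (sigma_gt : - (beta0 p ^+ 2 / (alpha p * gamma p - beta0 p ^+ 2)) < sigma p)
  (sigma_lt0 : sigma p < 0) (rho_lt0 : rho p < 0) (Vedd_lt0 : Vedd p < 0)
  (D_gt0 : 0 < D) :
  exists F : (R * R) * (R * R) -> (R * R) * (R * R),
    is_dynamics_of p h D F /\ asymptotically_stable F ((0, 0), (0, 0)).
Proof.
have h_neq0 : h != 0 by rewrite gt_eqF.
have gamma_neq0 : gamma p != 0 by rewrite gt_eqF.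
set A := alpha p * gamma p - beta0 p ^+ 2 in nondeg sigma_gt *.
(* The interval for sigma is nonempty only if this quotient is positive, which forces both [A > 0]
   and [beta0 p != 0]. *)
have beta_A : 0 < beta0 p ^+ 2 / A by rewrite -oppr_lt0 (lt_trans sigma_gt).
have A0 : 0 < A.
  rewrite lt_neqAle eq_sym nondeg leNgt; apply/negP => A_lt0.
  by move: beta_A; apply/negP; rewrite -leNgt mulr_ge0_le0 ?sqr_ge0 // invr_le0 ltW.
have beta_neq0 : beta0 p != 0.
  by apply: contraTneq beta_A => ->; rewrite expr0n mul0r ltxx.
pose a := shape_mass p; pose g := - (rho p * gamma p); pose d := coupling p.
pose U := - (h ^+ 2 * V1dd p / 4); pose W := - (h ^+ 2 * Vedd p / 4).
have a0 : 0 < a.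
  (* Over a common denominator, positivity of the shape mass is exactly the lower bound on sigma. *)
  have -> : a = (sigma p * A + beta0 p ^+ 2) / (gamma p * - sigma p).
    by rewrite /a /shape_mass /A; field; rewrite gamma_neq0 sigma_neq0.
  rewrite divr_gt0 //; last by rewrite mulr_gt0 ?oppr_gt0.
  by move: sigma_gt; rewrite -mulNr ltr_pdivrMr // -subr_gt0 opprK.
have g0 : 0 < g by rewrite oppr_gt0 nmulr_rlt0.
have d0 : d != 0 by rewrite mulf_neq0 ?invr_neq0 ?mulf_neq0.
have hV V : V < 0 -> 0 < - (h ^+ 2 * V / 4).
  by move=> V0; rewrite oppr_gt0 pmulr_llt0 // pmulr_rlt0 // exprn_gt0.
have U0 : 0 < U by exact: hV.
have W0 : 0 < W by exact: hV.
have K0 : 0 < D / 2 by rewrite divr_gt0.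
pose w z := reduced_next a g d U W (D / 2)
  z.1.1 (xcoord p z.1) z.2.1 (xcoord p z.2).
have wP z phi x : reduced_system a g d U W (D / 2) z.1.1 (xcoord p z.1) z.2.1
    (xcoord p z.2) phi x <-> (phi, x) = w z.
  exact: (@reduced_systemP _ _ _ _ _ _ _ _ _ _ _ (phi, x)).
clearbody w.
(* [w] returns (phi, x), so s is recovered as x - [xcoef p] phi. *)
pose F (z : (R * R) * (R * R)) := (z.2, ((w z).1, (w z).2 - xcoef p * (w z).1)).
have Fdyn : is_dynamics_of p h D F.
  move=> z [w1 [phi s]] /=.
  rewrite discrete_systemE // -/a -/g -/d -/U -/W wP /F.
  split=> [[-> -> ->]|[-> <-]]; rewrite /xcoord /=.
  - by rewrite subrK -surjective_pairing.
  - by rewrite addrK.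
exists F; split=> //.
apply: (asymptotically_stable_reduced a0 g0 d0 U0 W0 K0 (p := p)).
(* The zero sequence solves the system, and successors are unique. *)
- apply/esym/Fdyn; split=> //; rewrite discrete_systemE // /xcoord /=.
  by split; ring.
- move=> z; have /Fdyn [F1 sys] := erefl (F z); split=> //.
  by move: sys; rewrite discrete_systemE.
Qed.
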